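(* Let $L=\mathbb Z^4\subset\mathbb R^4$ with the bilinear form $B(x,y)=xGy^T$, where $G=\begin{pmatrix}2&-1&0&0\\-1&2&-1&-1\\0&-1&2&0\\0&-1&0&2\end{pmatrix}$ (the $D_4$ lattice), and $Q(x)=\frac12B(x,x)$. For $\alpha\in L^\sharp$ and $\beta\in\frac12\mathbb Z^4$ put $\theta_{\alpha,\beta}(\tau,z)=\sum_{v\in\mathbb Z^4}e(B(\beta,v))\,e(\tau Q(\alpha+v)+B(\alpha+v,z))$ on $\mathbb H\times\mathbb C^4$. Let $A=\{(0,0,0,0),(0,0,\frac12,\frac12),(\frac12,0,0,\frac12),(\frac12,0,\frac12,0)\}$ and $\mathcal B=\{(0,0,0,0),(\frac12,\frac12,\frac12,\frac12),(\frac12,0,0,0),(0,\frac12,0,0)\}$. Then the seven functions $\theta_{\alpha,0}^2$ ($\alpha\in A$) and $\theta_{0,\beta}^2$ ($\beta\in\mathcal B$) are $\mathbb C$-linearly independent. Moreover, for any $\alpha\in L^\sharp$ and $\beta\in\frac12\mathbb Z^4$, $$\theta_{\alpha,\beta}^2+\theta_{0,0}^2=\theta_{\alpha,0}^2+\theta_{0,\beta}^2.$$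
   Context: $e(x)=\exp(2\pi ix)$, $\mathbb H$ the upper half plane; $B$ extended bilinearly to $\mathbb C^4$; $L^\sharp=\{v\in\mathbb R^4:B(v,L)\subseteq\mathbb Z\}$ (here $A$ is a set of representatives of $L^\sharp/L$). *)

(* Defs.v *)
From Stdlib Require Import Reals ZArith Lra.
From Coquelicot Require Import Coquelicot.
Open Scope R_scope.

(* Vectors in R^4 / C^4 / Z^4 are functions on nat; only indices 0..3 matter. *)
Definition sum4 {G : AbelianMonoid} (f : nat -> G) : G := sum_n f 3.

Definition Gm (i j : nat) : R :=
  match i, j with
  | 0, 0 => 2 | 0, 1 => -1
  | 1, 0 => -1 | 1, 1 => 2 | 1, 2 => -1 | 1, 3 => -1
  | 2, 1 => -1 | 2, 2 => 2
  | 3, 1 => -1 | 3, 3 => 2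
  | _, _ => 0
  end.

Definition Bil (x y : nat -> R) : R :=
  sum4 (fun i => sum4 (fun j => x i * Gm i j * y j)).
Definition BilC (x : nat -> R) (z : nat -> C) : C :=
  sum4 (fun i => sum4 (fun j => Cmult (RtoC (x i * Gm i j)) (z j))).
Definition Qf (x : nat -> R) : R := Bil x x / 2.

(* e(w) = exp(2 pi i w) for complex w *)
Definition ee (w : C) : C :=
  Cmult (RtoC (exp (- (2 * PI * Im w))))
        (cos (2 * PI * Re w), sin (2 * PI * Re w)).

Definition Zvec (v : nat -> Z) : nat -> R := fun i => IZR (v i).
Definition vadd (x y : nat -> R) : nat -> R := fun i => x i + y i.
Definition vec4 (a b c d : R) : nat -> R :=
  fun i => match i with 0 => a | 1 => b | 2 => c | 3 => d | _ => 0 end.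

Definition in_Ldual (a : nat -> R) : Prop :=
  forall v : nat -> Z, exists k : Z, Bil a (Zvec v) = IZR k.
Definition in_halfZ4 (b : nat -> R) : Prop :=
  forall i : nat, (i < 4)%nat -> exists k : Z, b i = IZR k / 2.
(* vectors are only meaningful on indices 0..3 *)
Definition supp4 (x : nat -> R) : Prop := forall i : nat, (4 <= i)%nat -> x i = 0.

Definition theta_term (a b : nat -> R) (tau : C) (z : nat -> C) (v : nat -> Z) : C :=
  Cmult (ee (RtoC (Bil b (Zvec v))))
        (ee (Cplus (Cmult tau (RtoC (Qf (vadd a (Zvec v))))) (BilC (vadd a (Zvec v)) z))).

Definition box_sum (f : (nat -> Z) -> C) (N : nat) : C :=
  let s := fun k : nat => (Z.of_nat k - Z.of_nat N)%Z in
  sum_n (fun i0 => sum_n (fun i1 => sum_n (fun i2 => sum_n (fun i3 =>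
    f (fun i => match i with 0 => s i0 | 1 => s i1 | 2 => s i2 | 3 => s i3 | _ => 0%Z end))
    (2 * N)) (2 * N)) (2 * N)) (2 * N).

(* theta_{alpha,beta}(tau,z) = sum over v in Z^4 (absolutely convergent for Im tau > 0),
   computed as the limit of the box partial sums, componentwise. *)
Definition theta (a b : nat -> R) (tau : C) (z : nat -> C) : C :=
  (real (Lim_seq (fun N => Re (box_sum (theta_term a b tau z) N))),
   real (Lim_seq (fun N => Im (box_sum (theta_term a b tau z) N)))).

Definition theta2 (a b : nat -> R) (tau : C) (z : nat -> C) : C :=
  Cmult (theta a b tau z) (theta a b tau z).

Definition zero4 : nat -> R := vec4 0 0 0 0.

Definition Aset (k : nat) : nat -> R :=
  match k with
  | 0 => vec4 0 0 0 0 | 1 => vec4 0 0 (1/2) (1/2)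
  | 2 => vec4 (1/2) 0 0 (1/2) | _ => vec4 (1/2) 0 (1/2) 0
  end.
Definition Bset (k : nat) : nat -> R :=
  match k with
  | 0 => vec4 0 0 0 0 | 1 => vec4 (1/2) (1/2) (1/2) (1/2)
  | 2 => vec4 (1/2) 0 0 0 | _ => vec4 0 (1/2) 0 0
  end.

(* the seven functions: theta_{alpha,0}^2 (alpha in A, k = 0..3) and
   theta_{0,beta}^2 (beta in B \ {0}, k = 4..6; beta = 0 gives theta_{0,0}^2 again) *)
Definition seven (k : nat) : C -> (nat -> C) -> C :=
  match k with
  | 0 => theta2 (Aset 0) zero4 | 1 => theta2 (Aset 1) zero4
  | 2 => theta2 (Aset 2) zero4 | 3 => theta2 (Aset 3) zero4
  | 4 => theta2 zero4 (Bset 1) | 5 => theta2 zero4 (Bset 2)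
  | _ => theta2 zero4 (Bset 3)
  end.

(* Main.v *)
Require Import Defs.
From Stdlib Require Import Reals ZArith.
From Coquelicot Require Import Coquelicot.
From Stdlib Require Import List Permutation Lra Lia Psatz Classical FinFun.

(** Put [s = (a+v) + (a+w)] and [d = v - w] in the double sum for [theta_{a,b}^2].  Since
    [Q(x) + Q(y) = (Q(x+y) + Q(x-y)) / 2], sorting by the common class [m] of [s - 2a] and [d]
    in [L/2L] gives
      [theta_{a,b}(tau,z)^2
         = sum_m e(B(b,m)) theta_{m/2,0}(2 tau,0) theta_{a+m/2,0}(2 tau,2z)].
    By reflections and the symmetries of the Dynkin diagram the theta constants
    [theta_{m/2,0}(2 tau,0)] take only three values: [h0] at [m = 0], [h1] at the other classes
    of [2L^#], [h2] at the twelve classes of roots.  As [m |-> e(B(b,m))] is trivial on [2L^#]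
    and translation by [2a] preserves the cosets of [2L^#], on each of which outside [2L^#] the
    theta constant is [h2], the relation is an identity between finite sums.

    For independence, choose [z] with [B(x,2z) = sum_i w_i x_i], [w] in [{0,1}^4]; then
    [theta_{m/2,0}(2 tau,2z) = (-1)^(w.m) theta_{m/2,0}(2 tau,0)], and Fourier inversion in [w]
    separates the classes [m].  The resulting linear system in the coefficients is nonsingular
    as soon as [h0 <> h1], [h0 + 3 h1 <> 0] and [h0, h1, h2] are nonzero, which holds for
    [tau = iy] with [y] large. *)

(** * Absolutely summable families *)

(** Sums over finite lists, for real and complex values alike, make it possible to exhaust an
    arbitrary index type and to rearrange freely. *)
Definition lsum {G : AbelianMonoid} {U : Type} (f : U -> G) (l : list U) : G :=
  fold_right (fun x s => plus (f x) s) zero l.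

Lemma lsum_app {G : AbelianMonoid} {U : Type} (f : U -> G) l1 l2 :
  lsum f (l1 ++ l2) = plus (lsum f l1) (lsum f l2).
Proof.
  induction l1 as [|x l1 IH]; simpl.
  - now rewrite plus_zero_l.
  - now rewrite IH, plus_assoc.
Qed.

Lemma lsum_ext {G : AbelianMonoid} {U : Type} (f g : U -> G) l :
  (forall x, f x = g x) -> lsum f l = lsum g l.
Proof. intros H; induction l as [|x l IH]; simpl; congruence. Qed.

Lemma lsum_map {G : AbelianMonoid} {U V : Type} (f : V -> G) (h : U -> V) l :
  lsum f (map h l) = lsum (fun x => f (h x)) l.
Proof. induction l as [|x l IH]; simpl; congruence. Qed.

Lemma lsum_list_prod {G : AbelianMonoid} {U V : Type} (f : U * V -> G) l1 l2 :
  lsum f (list_prod l1 l2) = lsum (fun x => lsum (fun y => f (x, y)) l2) l1.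
Proof.
  induction l1 as [|x l1 IH]; simpl; [easy|].
  now rewrite lsum_app, IH, lsum_map.
Qed.

Lemma lsum_perm {G : AbelianMonoid} {U : Type} (f : U -> G) l1 l2 :
  Permutation l1 l2 -> lsum f l1 = lsum f l2.
Proof.
  induction 1 as [|x l1 l2 _ IH|x y l|l1 l2 l3 _ IH1 _ IH2]; simpl.
  - easy.
  - now rewrite IH.
  - rewrite !plus_assoc. f_equal. apply plus_comm.
  - congruence.
Qed.

Lemma lsum_plus {G : AbelianMonoid} {U : Type} (f g : U -> G) l :
  lsum (fun x => plus (f x) (g x)) l = plus (lsum f l) (lsum g l).
Proof.
  induction l as [|x l IH]; simpl; [now rewrite plus_zero_l|].
  rewrite IH, !plus_assoc. f_equal. rewrite <- !plus_assoc. f_equal. apply plus_comm.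
Qed.

Lemma lsum_comm {G : AbelianMonoid} {U V : Type} (f : U -> V -> G) l1 l2 :
  lsum (fun x => lsum (f x) l2) l1 = lsum (fun y => lsum (fun x => f x y) l1) l2.
Proof.
  induction l1 as [|x l1 IH]; simpl.
  - induction l2 as [|y l2 IH]; simpl; [easy|]. now rewrite <- IH, plus_zero_l.
  - now rewrite IH, lsum_plus.
Qed.

Lemma lsum_seq {G : AbelianMonoid} (f : nat -> G) n :
  lsum f (seq 0 (S n)) = sum_n f n.
Proof.
  induction n as [|n IH].
  - simpl. now rewrite plus_zero_r, sum_O.
  - rewrite seq_S, lsum_app, IH, sum_Sn. simpl. now rewrite plus_zero_r.
Qed.

Section RealSums.
Context {U : Type}.
Implicit Types (f g : U -> R) (l : list U).

Lemma lsum_ge0 f l : (forall x, 0 <= f x) -> 0 <= lsum f l.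
Proof.
  intros H; induction l as [|x l IH]; simpl; [apply Rle_refl|].
  apply Rplus_le_le_0_compat; auto.
Qed.

Lemma lsum_le f g l : (forall x, f x <= g x) -> lsum f l <= lsum g l.
Proof.
  intros H; induction l as [|x l IH]; simpl; [apply Rle_refl|].
  apply Rplus_le_compat; auto.
Qed.

Lemma lsum_scal_l f l a : lsum (fun x => a * f x) l = a * lsum f l.
Proof.
  induction l as [|x l IH]; simpl; unfold plus, zero in *; simpl in *;
    [|rewrite IH]; ring.
Qed.

Lemma Rabs_lsum_le f l : Rabs (lsum f l) <= lsum (fun x => Rabs (f x)) l.
Proof.
  induction l as [|x l IH]; simpl.
  - unfold zero; simpl; rewrite Rabs_R0; lra.
  - unfold plus in *; simpl in *.
    eapply Rle_trans; [apply Rabs_triang|]. lra.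
Qed.

Lemma NoDup_incl_split (l1 l2 : list U) :
  NoDup l1 -> incl l1 l2 -> exists r, Permutation l2 (l1 ++ r).
Proof.
  revert l2; induction l1 as [|x l1 IH]; intros l2 Hd Hi.
  - exists l2; easy.
  - inversion_clear Hd as [|? ? Hx Hd'].
    destruct (in_split x l2) as (u & v & ->); [apply Hi; now left|].
    destruct (IH (u ++ v)) as [r Hr]; [easy| |].
    + intros y Hy. assert (Hy' := Hi y (or_intror Hy)).
      apply in_app_iff in Hy'. apply in_app_iff.
      destruct Hy' as [?|[->|?]]; [now left|easy|now right].
    + exists r. simpl. rewrite <- Hr. symmetry. apply Permutation_middle.
Qed.

Lemma lsum_incl_le f l1 l2 :
  (forall x, 0 <= f x) -> NoDup l1 -> incl l1 l2 -> lsum f l1 <= lsum f l2.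
Proof.
  intros Hf Hd Hi. destruct (NoDup_incl_split l1 l2 Hd Hi) as [r Hr].
  rewrite (lsum_perm f _ _ Hr), lsum_app. unfold plus; simpl.
  assert (H := lsum_ge0 f r Hf). lra.
Qed.

(** Equality on [U] need not be decidable, so repetitions are removed by excluded middle. *)
Lemma exists_NoDup_incl (l : list U) : exists l', NoDup l' /\ incl l l'.
Proof.
  induction l as [|x l (l' & Hd & Hi)].
  - exists nil; split; [constructor|easy].
  - destruct (classic (In x l')) as [Hx|Hx].
    + exists l'; split; [easy|]. intros y [<-|Hy]; auto.
    + exists (x :: l'); split; [now constructor|].
      intros y [<-|Hy]; [now left|right; auto].
Qed.

End RealSums.

Definition summable {U : Type} (f : U -> R) : Prop :=
  exists M, forall l, NoDup l -> lsum (fun x => Rabs (f x)) l <= M.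

Lemma summable_le {U : Type} (f g : U -> R) K :
  0 <= K -> (forall x, Rabs (f x) <= K * Rabs (g x)) -> summable g -> summable f.
Proof.
  intros HK H [M HM]. exists (K * M). intros l Hl.
  eapply Rle_trans; [apply lsum_le, H|].
  rewrite lsum_scal_l. apply Rmult_le_compat_l; auto.
Qed.

Lemma summable_prod {U V : Type} (f : U -> R) (g : V -> R) :
  summable f -> summable g -> summable (fun p => f (fst p) * g (snd p)).
Proof.
  intros [M HM] [N HN]. exists (M * N). intros l Hl.
  (* The list is enlarged to a rectangle containing its two projections, where the sum of absolute
     values factors. *)
  destruct (exists_NoDup_incl (map fst l)) as (l1 & Hd1 & Hi1).
  destruct (exists_NoDup_incl (map snd l)) as (l2 & Hd2 & Hi2).
  apply Rle_trans with
    (lsum (fun p : U * V => Rabs (f (fst p) * g (snd p))) (list_prod l1 l2)).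
  - apply lsum_incl_le; [intros; apply Rabs_pos|easy|].
    intros [x y] Hxy. apply in_prod.
    + apply Hi1. now apply (in_map fst) in Hxy.
    + apply Hi2. now apply (in_map snd) in Hxy.
  - rewrite lsum_list_prod; simpl.
    rewrite (lsum_ext _ (fun x => lsum (fun y => Rabs (g y)) l2 * Rabs (f x))).
    + rewrite lsum_scal_l, Rmult_comm.
      apply Rmult_le_compat; auto; apply lsum_ge0; intros; apply Rabs_pos.
    + intros x. rewrite Rmult_comm, <- lsum_scal_l. apply lsum_ext.
      intros y. apply Rabs_mult.
Qed.

(** The lists need not increase: it suffices that each index eventually enters and never leaves. *)
Definition exhausts {U : Type} (E : nat -> list U) : Prop :=
  (forall n, NoDup (E n)) /\ (forall x, eventually (fun n => In x (E n))).

Lemma exhausts_incl {U : Type} (E : nat -> list U) l :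
  exhausts E -> eventually (fun n => incl l (E n)).
Proof.
  intros [_ H]. induction l as [|x l IH].
  - exists 0%nat; easy.
  - generalize (filter_and _ _ (H x) IH). apply filter_imp.
    intros n [Hx Hl] y [<-|Hy]; auto.
Qed.

Lemma NoDup_list_prod {U V : Type} (l1 : list U) (l2 : list V) :
  NoDup l1 -> NoDup l2 -> NoDup (list_prod l1 l2).
Proof.
  intros H1 H2. induction H1 as [|x l1 Hx H1 IH]; simpl; [constructor|].
  apply NoDup_app; [|easy|].
  - apply Injective_map_NoDup; [|easy]. intros y y' E. congruence.
  - intros [a b] Ha Hb. apply in_map_iff in Ha. destruct Ha as (y & E & _).
    apply in_prod_iff in Hb. destruct Hb as [Hb _]. congruence.
Qed.

Lemma exhausts_prod {U V : Type} (E : nat -> list U) (F : nat -> list V) :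
  exhausts E -> exhausts F -> exhausts (fun n => list_prod (E n) (F n)).
Proof.
  intros [HE1 HE2] [HF1 HF2]. split.
  - intros n. now apply NoDup_list_prod.
  - intros [x y]. generalize (filter_and _ _ (HE2 x) (HF2 y)). apply filter_imp.
    intros n [? ?]. now apply in_prod.
Qed.

Lemma exhausts_const {U : Type} (l : list U) :
  NoDup l -> (forall x, In x l) -> exhausts (fun _ => l).
Proof. intros H1 H2; split; [easy|]. intros x. exists 0%nat; easy. Qed.

Lemma exhausts_map {U V : Type} (h : U -> V) (E : nat -> list U) :
  Injective h -> (forall y, exists x, h x = y) ->
  exhausts E -> exhausts (fun n => map h (E n)).
Proof.
  intros Hi Hs [H1 H2]. split.
  - intros n. now apply Injective_map_NoDup.
  - intros y. destruct (Hs y) as [x <-]. generalize (H2 x). apply filter_imp.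
    intros n. apply in_map.
Qed.

(** Take [l] whose sum of absolute values is within [eps] of the supremum [m] of all such sums;
    whatever lies outside [l] then adds less than [eps]. The list is chosen before the exhaustion
    [E], which is what makes rearrangement possible. *)
Lemma summable_tail {U : Type} (f : U -> R) (eps : posreal) :
  summable f ->
  exists l, forall E, exhausts E ->
    eventually (fun n => Rabs (lsum f (E n) - lsum f l) < eps).
Proof.
  intros [M HM].
  pose (S := fun y => exists l, NoDup l /\ y = lsum (fun x => Rabs (f x)) l).
  destruct (completeness S) as [m [Hm1 Hm2]].
  - exists M. intros y (l & Hl & ->). auto.
  - exists (lsum (fun x => Rabs (f x)) nil), nil. split; [constructor|easy].
  - destruct (classic (exists l, NoDup l /\ m - eps < lsum (fun x => Rabs (f x)) l))
      as [(l & Hd & Hl)|HN].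
    + exists l. intros E HE. generalize (exhausts_incl E l HE). apply filter_imp.
      intros n Hn. destruct HE as [HE _].
      destruct (NoDup_incl_split l (E n) Hd Hn) as [r Hr].
      rewrite (lsum_perm f _ _ Hr), lsum_app.
      change (Rabs (Rplus (lsum f l) (lsum f r) - lsum f l) < eps).
      rewrite Rplus_minus_l.
      eapply Rle_lt_trans; [apply Rabs_lsum_le|].
      assert (H : lsum (fun x => Rabs (f x)) (E n) <= m)
        by (apply Hm1; now exists (E n)).
      rewrite (lsum_perm _ _ _ Hr), lsum_app in H.
      unfold plus in H; simpl in H. lra.
    + assert (m <= m - eps); [|destruct eps; simpl in *; lra].
      apply Hm2. intros y (l & Hl & ->). apply Rnot_lt_le. intros Hlt.
      apply HN. now exists l.
Qed.

Lemma summable_cv {U : Type} (f : U -> R) (E : nat -> list U) :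
  summable f -> exhausts E -> ex_finite_lim_seq (fun n => lsum f (E n)).
Proof.
  intros Hf HE. apply ex_lim_seq_cauchy_corr. intros eps.
  destruct (summable_tail f (pos_div_2 eps) Hf) as [l Hl].
  destruct (Hl E HE) as [N HN]. exists N. intros n p Hn Hp.
  assert (H1 := HN n Hn). assert (H2 := HN p Hp). simpl in H1, H2.
  apply Rabs_def2 in H1. apply Rabs_def2 in H2. apply Rabs_def1; lra.
Qed.

(** Both exhaustions are eventually close to the sum over the same finite list, hence to each
    other. *)
Lemma summable_rearrange {U : Type} (f : U -> R) (E E' : nat -> list U) (s : R) :
  summable f -> exhausts E -> exhausts E' ->
  is_lim_seq (fun n => lsum f (E n)) s -> is_lim_seq (fun n => lsum f (E' n)) s.
Proof.
  intros Hf HE HE' Hs. apply is_lim_seq_spec in Hs. apply is_lim_seq_spec.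
  intros eps. pose (e3 := mkposreal (eps / 3) ltac:(destruct eps; simpl; lra)).
  destruct (summable_tail f e3 Hf) as [l Hl].
  generalize (filter_and _ _ (filter_and _ _ (Hl E HE) (Hl E' HE')) (Hs e3)).
  intros [N HN]. exists N; intros n Hn. destruct (HN n Hn) as [[H1 H2] H3].
  simpl in H1, H2, H3.
  apply Rabs_def2 in H1. apply Rabs_def2 in H2. apply Rabs_def2 in H3.
  apply Rabs_def1; lra.
Qed.

(** * Limits and rearrangement of complex sums *)

Definition Clim (u : nat -> C) (s : C) : Prop :=
  is_lim_seq (fun n => Re (u n)) (Re s) /\ is_lim_seq (fun n => Im (u n)) (Im s).

Lemma Clim_ext u v s : (forall n, u n = v n) -> Clim u s -> Clim v s.
Proof.
  intros H [H1 H2]. split; [eapply is_lim_seq_ext; [|exact H1]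
    |eapply is_lim_seq_ext; [|exact H2]]; intros n; simpl; now rewrite H.
Qed.

Lemma Clim_unique u s t : Clim u s -> Clim u t -> s = t.
Proof.
  intros [H1 H2] [H3 H4].
  apply is_lim_seq_unique in H1, H2, H3, H4.
  rewrite H1 in H3. rewrite H2 in H4. destruct s, t; simpl in *. congruence.
Qed.

Lemma Clim_const (s : C) : Clim (fun _ => s) s.
Proof. split; apply is_lim_seq_const. Qed.

Lemma Clim_plus u v s t :
  Clim u s -> Clim v t -> Clim (fun n => Cplus (u n) (v n)) (Cplus s t).
Proof. intros [] []. split; simpl; now apply is_lim_seq_plus'. Qed.

Lemma Clim_mult u v s t :
  Clim u s -> Clim v t -> Clim (fun n => Cmult (u n) (v n)) (Cmult s t).
Proof.
  intros [] []. split; simpl.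
  - apply is_lim_seq_minus'; now apply is_lim_seq_mult'.
  - apply is_lim_seq_plus'; now apply is_lim_seq_mult'.
Qed.

Lemma Clim_lsum {U : Type} (u : U -> nat -> C) (s : U -> C) l :
  (forall x, Clim (u x) (s x)) ->
  Clim (fun n => lsum (fun x => u x n) l) (lsum s l).
Proof.
  intros H. induction l as [|x l IH]; simpl.
  - apply Clim_const.
  - now apply Clim_plus.
Qed.

Lemma Re_lsum {U : Type} (f : U -> C) l : Re (lsum f l) = lsum (fun x => Re (f x)) l.
Proof. induction l as [|x l IH]; simpl; [easy|]. now rewrite <- IH. Qed.

Lemma Im_lsum {U : Type} (f : U -> C) l : Im (lsum f l) = lsum (fun x => Im (f x)) l.
Proof. induction l as [|x l IH]; simpl; [easy|]. now rewrite <- IH. Qed.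

Lemma lsum_Cmult_l {U : Type} (f : U -> C) (a : C) l :
  lsum (fun x => Cmult a (f x)) l = Cmult a (lsum f l).
Proof.
  induction l as [|x l IH]; simpl; unfold zero; simpl.
  - now rewrite Cmult_0_r.
  - rewrite IH. change plus with Cplus. ring.
Qed.

Lemma lsum_Cmult_prod {U V : Type} (f : U -> C) (g : V -> C) l1 l2 :
  lsum (fun p => Cmult (f (fst p)) (g (snd p))) (list_prod l1 l2)
  = Cmult (lsum f l1) (lsum g l2).
Proof.
  rewrite lsum_list_prod. simpl.
  rewrite (lsum_ext _ (fun x => Cmult (lsum g l2) (f x))).
  - rewrite lsum_Cmult_l. apply Cmult_comm.
  - intros x. rewrite lsum_Cmult_l. apply Cmult_comm.
Qed.

Lemma Rabs_Im_le_Cmod (c : C) : Rabs (Im c) <= Cmod c.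
Proof. eapply Rle_trans; [|apply Rmax_Cmod]. apply Rmax_r. Qed.

Lemma summable_Re {U : Type} (f : U -> C) :
  summable (fun x => Cmod (f x)) -> summable (fun x => Re (f x)).
Proof.
  apply (summable_le _ _ 1); [lra|]. intros x. rewrite Rmult_1_l.
  eapply Rle_trans; [apply re_le_Cmod|apply Rle_abs].
Qed.

Lemma summable_Im {U : Type} (f : U -> C) :
  summable (fun x => Cmod (f x)) -> summable (fun x => Im (f x)).
Proof.
  apply (summable_le _ _ 1); [lra|]. intros x. rewrite Rmult_1_l.
  eapply Rle_trans; [apply Rabs_Im_le_Cmod|apply Rle_abs].
Qed.

Lemma Clim_rearrange {U : Type} (f : U -> C) (E E' : nat -> list U) (s : C) :
  summable (fun x => Cmod (f x)) -> exhausts E -> exhausts E' ->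
  Clim (fun n => lsum f (E n)) s -> Clim (fun n => lsum f (E' n)) s.
Proof.
  intros Hf HE HE' [H1 H2]. split.
  - eapply is_lim_seq_ext; [intros; symmetry; apply Re_lsum|].
    eapply summable_rearrange; [now apply summable_Re|exact HE|easy|].
    eapply is_lim_seq_ext; [|exact H1]. intros; apply Re_lsum.
  - eapply is_lim_seq_ext; [intros; symmetry; apply Im_lsum|].
    eapply summable_rearrange; [now apply summable_Im|exact HE|easy|].
    eapply is_lim_seq_ext; [|exact H2]. intros; apply Im_lsum.
Qed.

(** * Theta series as rearrangeable sums *)

Notation Z4 := (Z * (Z * (Z * Z)))%type.
Notation B4 := (bool * (bool * (bool * bool)))%type.

(** Tuples have coordinatewise Leibniz equality, needed for injectivity of reindexings; functions on
    [nat] would require extensionality. The match is convertible to the one in [box_sum]. *)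
Definition zfun (p : Z4) : nat -> Z :=
  fun i => match i with
           | 0%nat => fst p
           | 1%nat => fst (snd p)
           | 2%nat => fst (snd (snd p))
           | 3%nat => snd (snd (snd p))
           | _ => 0%Z
           end.

Definition rfun (p : Z4) : nat -> R := Zvec (zfun p).
Definition half (p : Z4) : nat -> R := fun i => rfun p i / 2.
(** [B4] encodes L/2L by coordinate parities; this picks the representative with entries 0 and 1. *)
Definition bits (m : B4) : Z4 :=
  (Z.b2z (fst m), (Z.b2z (fst (snd m)),
   (Z.b2z (fst (snd (snd m))), Z.b2z (snd (snd (snd m)))))).

Definition zrange (N : nat) : list Z :=
  map (fun k => (Z.of_nat k - Z.of_nat N)%Z) (seq 0 (S (2 * N))).
Definition box (N : nat) : list Z4 :=
  list_prod (zrange N) (list_prod (zrange N) (list_prod (zrange N) (zrange N))).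
Definition cube : list B4 :=
  list_prod (false :: true :: nil) (list_prod (false :: true :: nil)
    (list_prod (false :: true :: nil) (false :: true :: nil))).

Lemma exhausts_zrange : exhausts zrange.
Proof.
  split.
  - intros N. apply Injective_map_NoDup; [|apply seq_NoDup]. intros i j H. lia.
  - intros x. exists (Z.abs_nat x). intros N HN. apply in_map_iff.
    exists (Z.to_nat (x + Z.of_nat N)). split; [lia|]. apply in_seq. lia.
Qed.

Lemma exhausts_box : exhausts box.
Proof. repeat apply exhausts_prod; apply exhausts_zrange. Qed.

Lemma exhausts_cube : exhausts (fun _ => cube).
Proof.
  assert (H : exhausts (fun _ => false :: true :: nil)).
  { apply exhausts_const.
    - repeat constructor; simpl; intuition congruence.
    - intros []; simpl; auto. }
  repeat apply (exhausts_prod (fun _ => _) (fun _ => _)); exact H.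
Qed.

Lemma box_sum_lsum (f : (nat -> Z) -> C) N :
  box_sum f N = lsum (fun p => f (zfun p)) (box N).
Proof.
  unfold box_sum, box, zrange. rewrite lsum_list_prod, lsum_map, lsum_seq.
  apply sum_n_ext; intros i0. rewrite lsum_list_prod, lsum_map, lsum_seq.
  apply sum_n_ext; intros i1. rewrite lsum_list_prod, lsum_map, lsum_seq.
  apply sum_n_ext; intros i2. rewrite lsum_map, lsum_seq.
  reflexivity.
Qed.

(** * The bilinear form and the exponential *)

Lemma sum4E {G : AbelianMonoid} (f : nat -> G) :
  sum4 f = plus (plus (plus (f 0%nat) (f 1%nat)) (f 2%nat)) (f 3%nat).
Proof. unfold sum4. now rewrite !sum_Sn, sum_O. Qed.

Lemma BilE x y :
  Bil x y = 2 * (x 0%nat * y 0%nat + x 1%nat * y 1%nat + x 2%nat * y 2%nat + x 3%nat * y 3%nat)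
    - x 0%nat * y 1%nat - x 1%nat * y 0%nat - x 1%nat * y 2%nat - x 2%nat * y 1%nat
    - x 1%nat * y 3%nat - x 3%nat * y 1%nat.
Proof.
  unfold Bil. rewrite !sum4E. unfold plus; simpl. ring.
Qed.

Lemma Re_BilC x z : Re (BilC x z) = Bil x (fun j => Re (z j)).
Proof.
  rewrite BilE. unfold BilC. rewrite !sum4E.
  unfold plus; simpl. unfold Re. ring.
Qed.

Lemma Im_BilC x z : Im (BilC x z) = Bil x (fun j => Im (z j)).
Proof.
  rewrite BilE. unfold BilC. rewrite !sum4E.
  unfold plus; simpl. unfold Im. ring.
Qed.

Lemma ee_plus w1 w2 : ee (Cplus w1 w2) = Cmult (ee w1) (ee w2).
Proof.
  unfold ee, Re, Im. apply injective_projections; simpl;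
    rewrite !Rmult_plus_distr_l, Ropp_plus_distr, exp_plus, ?cos_plus, ?sin_plus; ring.
Qed.

Lemma Cmod_ee w : Cmod (ee w) = exp (- (2 * PI * Im w)).
Proof.
  unfold ee. rewrite Cmod_mult, Cmod_R, Rabs_pos_eq by (left; apply exp_pos).
  assert (H : Cmod (cos (2 * PI * Re w), sin (2 * PI * Re w)) = 1).
  { unfold Cmod; simpl. rewrite !Rmult_1_r.
    replace (_ + _) with 1; [apply sqrt_1|].
    rewrite Rplus_comm. symmetry. apply sin2_cos2. }
  rewrite H. ring.
Qed.

Lemma ee_Z k : ee (RtoC (IZR k)) = RtoC 1.
Proof.
  assert (H : cos (2 * PI * IZR k) = 1 /\ sin (2 * PI * IZR k) = 0).
  { assert (Hn : forall n : nat, cos (2 * PI * INR n) = 1 /\ sin (2 * PI * INR n) = 0).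
    { intros n. replace (2 * PI * INR n) with (0 + 2 * INR n * PI) by ring.
      rewrite cos_period, sin_period. split; [apply cos_0|apply sin_0]. }
    destruct (Z_le_gt_dec 0 k) as [Hk|Hk].
    - rewrite <- (Z2Nat.id k), <- INR_IZR_INZ by easy. apply Hn.
    - replace (2 * PI * IZR k) with (- (2 * PI * IZR (- k))) by (rewrite opp_IZR; ring).
      rewrite <- (Z2Nat.id (- k)), <- INR_IZR_INZ, cos_neg, sin_neg by lia.
      destruct (Hn (Z.to_nat (- k))) as [-> ->]. split; ring. }
  destruct H as [Hc Hs].
  unfold ee. simpl. rewrite Hc, Hs, Rmult_0_r, Ropp_0, exp_0.
  apply injective_projections; simpl; ring.
Qed.

Lemma ee_half_odd k : ee (RtoC (IZR (2 * k + 1) / 2)) = RtoC (-1).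
Proof.
  replace (RtoC (IZR (2 * k + 1) / 2)) with (Cplus (RtoC (IZR k)) (RtoC (1 / 2))).
  - rewrite ee_plus, ee_Z. unfold ee. simpl.
    replace (2 * PI * (1 / 2)) with PI by field. rewrite cos_PI, sin_PI.
    rewrite Rmult_0_r, Ropp_0, exp_0. apply injective_projections; simpl; ring.
  - rewrite <- RtoC_plus, plus_IZR, mult_IZR. f_equal. field.
Qed.

(** * Absolute convergence of the theta series *)

Lemma exp_le_compat x y : x <= y -> exp x <= exp y.
Proof. intros [H| ->]; [left; now apply exp_increasing|apply Rle_refl]. Qed.

Definition expabs (k : Z) : R := exp (- Rabs (IZR k)).

Lemma summable_expabs : summable expabs.
Proof.
  (* The correction term makes the induction close, using only e > 2. *)
  assert (Hs : forall n, sum_n (fun k => exp (- INR k)) n <= 2 - exp (- INR n)).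
  { induction n as [|n IH].
    - rewrite sum_O. simpl. rewrite Ropp_0, exp_0. lra.
    - rewrite sum_Sn, S_INR. unfold plus; simpl.
      replace (- INR n) with (- (INR n + 1) + 1) in IH by ring.
      rewrite exp_plus in IH.
      assert (H1 := exp_ineq1 1 ltac:(lra)).
      assert (H2 := exp_pos (- (INR n + 1))). nra. }
  exists 4. intros l Hl.
  (* Zero is listed twice, which is harmless for an upper bound. *)
  pose (E := fun n => map Z.of_nat (seq 0 (S n))
                      ++ map (fun k => (- Z.of_nat k)%Z) (seq 0 (S n))).
  assert (HE : forall l, exists n, incl l (E n)).
  { clear. intros l. induction l as [|x l [n Hn]].
    - exists 0%nat. easy.
    - exists (max n (Z.abs_nat x)). intros y Hy. unfold E. apply in_app_iff.
      rewrite !in_map_iff.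
      assert (Hy' : (Z.abs_nat y <= max n (Z.abs_nat x))%nat).
      { destruct Hy as [<-|Hy]; [lia|]. apply Hn in Hy. unfold E in Hy.
        apply in_app_iff in Hy. rewrite !in_map_iff in Hy.
        destruct Hy as [(k & <- & Hk)|(k & <- & Hk)]; apply in_seq in Hk; lia. }
      destruct (Z_le_gt_dec 0 y); [left|right]; exists (Z.abs_nat y);
        (split; [lia|apply in_seq; lia]). }
  destruct (HE l) as [n Hn].
  eapply Rle_trans; [apply lsum_incl_le; [intros; apply Rabs_pos|exact Hl|exact Hn]|].
  assert (H : forall k x, Z.abs_nat x = k -> Rabs (expabs x) = exp (- INR k)).
  { intros k x <-. unfold expabs. rewrite Rabs_pos_eq by (left; apply exp_pos).
    now rewrite <- abs_IZR, INR_IZR_INZ, Zabs2Nat.id_abs. }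
  unfold E. rewrite lsum_app, !lsum_map, !lsum_seq.
  rewrite (sum_n_ext (fun k => Rabs (expabs (Z.of_nat k))) (fun k => exp (- INR k)))
    by (intros k; apply H; lia).
  rewrite (sum_n_ext (fun k => Rabs (expabs (- Z.of_nat k))) (fun k => exp (- INR k)))
    by (intros k; apply H; lia).
  specialize (Hs n). assert (Hp := exp_pos (- INR n)).
  change (Rplus (sum_n (fun k => exp (- INR k)) n) (sum_n (fun k => exp (- INR k)) n) <= 4).
  lra.
Qed.

(** Used in each coordinate to dominate a Gaussian with a linear term by a constant times exp(-|x|).
    [K] comes from completing the square in |a+x|, with linear coefficient -(1+|w|). *)
Lemma quadratic_ge_abs c a w :
  0 < c -> exists K, forall x, Rabs x - K <= c * (a + x) ^ 2 + (a + x) * w.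
Proof.
  intros Hc. exists (Rabs a + (1 + Rabs w) ^ 2 / (4 * c)). intros x.
  assert (H1 : Rabs x <= Rabs (a + x) + Rabs a).
  { replace x with ((a + x) + - a) at 1 by ring.
    rewrite <- (Rabs_Ropp a). apply Rabs_triang. }
  assert (H2 : - (Rabs (a + x) * Rabs w) <= (a + x) * w).
  { rewrite <- Rabs_mult. assert (H := Rle_abs (- ((a + x) * w))).
    rewrite Rabs_Ropp in H. lra. }
  assert (H3 : 0 <= c * (Rabs (a + x) - (1 + Rabs w) / (2 * c)) ^ 2).
  { apply Rmult_le_pos; [lra|apply pow2_ge_0]. }
  rewrite <- (pow2_abs (a + x)).
  replace (c * (Rabs (a + x) - (1 + Rabs w) / (2 * c)) ^ 2) with
    (c * Rabs (a + x) ^ 2 - Rabs (a + x) * (1 + Rabs w) + (1 + Rabs w) ^ 2 / (4 * c))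
    in H3 by (field; lra).
  lra.
Qed.

Lemma Cmod_theta_term a b tau z v :
  Cmod (theta_term a b tau z v)
  = exp (- (2 * PI * (Im tau * Qf (vadd a (Zvec v))
                      + Bil (vadd a (Zvec v)) (fun j => Im (z j))))).
Proof.
  unfold theta_term. rewrite Cmod_mult, !Cmod_ee, <- exp_plus, <- Im_BilC.
  f_equal. simpl. unfold Im. ring.
Qed.

(** Since Q(x) is at least |x|^2/8, the exponent splits into four one-variable quadratics, whose
    linear coefficients are 2 pi times the entries of G applied to Im z. *)
Lemma summable_theta_term a b tau z :
  0 < Im tau -> summable (fun p => Cmod (theta_term a b tau z (zfun p))).
Proof.
  intros Ht.
  pose (Y := fun j => Im (z j)).
  assert (Hc : 0 < 2 * PI * Im tau / 8) by (assert (H := PI_RGT_0); nra).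
  destruct (quadratic_ge_abs _ (a 0%nat) (2 * PI * (2 * Y 0%nat - Y 1%nat)) Hc) as [K0 H0].
  destruct (quadratic_ge_abs _ (a 1%nat)
    (2 * PI * (2 * Y 1%nat - Y 0%nat - Y 2%nat - Y 3%nat)) Hc) as [K1 H1].
  destruct (quadratic_ge_abs _ (a 2%nat) (2 * PI * (2 * Y 2%nat - Y 1%nat)) Hc) as [K2 H2].
  destruct (quadratic_ge_abs _ (a 3%nat) (2 * PI * (2 * Y 3%nat - Y 1%nat)) Hc) as [K3 H3].
  apply (summable_le _ (fun p : Z4 => expabs (fst p) * (expabs (fst (snd p))
      * (expabs (fst (snd (snd p))) * expabs (snd (snd (snd p)))))) (exp (K0 + K1 + K2 + K3))).
  - left; apply exp_pos.
  - intros (v0 & v1 & v2 & v3). simpl fst; simpl snd.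
    unfold expabs. rewrite <- !exp_plus, !Rabs_pos_eq, <- exp_plus
      by first [left; apply exp_pos|apply Cmod_ge_0].
    rewrite Cmod_theta_term. fold Y. apply exp_le_compat.
    specialize (H0 (IZR v0)). specialize (H1 (IZR v1)).
    specialize (H2 (IZR v2)). specialize (H3 (IZR v3)).
    (* Here Q(x) - |x|^2/8 equals 7/8 times the sum of (x_i - 4/7 x_1)^2 over i = 0, 2, 3, plus
       x_1^2/56. *)
    assert (HQ : forall x0 x1 x2 x3, 0 <= 2 * PI * Im tau * ((x0 ^ 2 + x1 ^ 2 + x2 ^ 2 + x3 ^ 2
        - x0 * x1 - x1 * x2 - x1 * x3) - (x0 ^ 2 + x1 ^ 2 + x2 ^ 2 + x3 ^ 2) / 8)).
    { intros. apply Rmult_le_pos; [lra|].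
      assert (Hx0 := pow2_ge_0 (x0 - 4 / 7 * x1)).
      assert (Hx2 := pow2_ge_0 (x2 - 4 / 7 * x1)).
      assert (Hx3 := pow2_ge_0 (x3 - 4 / 7 * x1)).
      assert (Hx1 := pow2_ge_0 x1). nra. }
    specialize (HQ (a 0%nat + IZR v0) (a 1%nat + IZR v1) (a 2%nat + IZR v2) (a 3%nat + IZR v3)).
    unfold Qf. rewrite !BilE. unfold vadd, Zvec; simpl zfun.
    set (X0 := a 0%nat + IZR v0) in *. set (X1 := a 1%nat + IZR v1) in *.
    set (X2 := a 2%nat + IZR v2) in *. set (X3 := a 3%nat + IZR v3) in *.
    lra.
  - exact (summable_prod _ _ summable_expabs (summable_prod _ _ summable_expabs
      (summable_prod _ _ summable_expabs summable_expabs))).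
Qed.

(** Summability makes both [Lim_seq] finite, so [real] returns true limits and not its default
    value. *)
Lemma theta_cv a b tau z : 0 < Im tau ->
  Clim (fun N => lsum (fun p => theta_term a b tau z (zfun p)) (box N)) (theta a b tau z).
Proof.
  intros Ht. assert (Hs := summable_theta_term a b tau z Ht).
  apply (Clim_ext (box_sum (theta_term a b tau z))); [intros; apply box_sum_lsum|].
  split; apply Lim_seq_correct'.
  - destruct (summable_cv _ box (summable_Re _ Hs) exhausts_box) as [l Hl].
    exists l. eapply is_lim_seq_ext; [|exact Hl].
    intros N. now rewrite box_sum_lsum, Re_lsum.
  - destruct (summable_cv _ box (summable_Im _ Hs) exhausts_box) as [l Hl].
    exists l. eapply is_lim_seq_ext; [|exact Hl].
    intros N. now rewrite box_sum_lsum, Im_lsum.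
Qed.

(** The common tool for translations, isometries and the points [dual_point]: a bijection of the
    index set that matches terms up to a constant factor. *)
Lemma theta_reindex (g : Z4 -> Z4) (c : C) a b tau z a' b' tau' z' :
  Injective g -> (forall q, exists p, g p = q) -> 0 < Im tau -> 0 < Im tau' ->
  (forall p, theta_term a' b' tau' z' (zfun p)
             = Cmult c (theta_term a b tau z (zfun (g p)))) ->
  theta a' b' tau' z' = Cmult c (theta a b tau z).
Proof.
  intros Hi Hs Ht Ht' H.
  apply (Clim_unique _ _ _ (theta_cv a' b' tau' z' Ht')).
  apply (Clim_ext (fun N => Cmult c
    (lsum (fun p => theta_term a b tau z (zfun p)) (map g (box N))))).
  - intros N. now rewrite (lsum_ext _ _ (box N) H), lsum_Cmult_l, lsum_map.
  - apply Clim_mult; [apply Clim_const|].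
    eapply Clim_rearrange; [now apply summable_theta_term|apply exhausts_box
      |apply exhausts_map; [easy..|apply exhausts_box]|now apply theta_cv].
Qed.

(** * The product formula *)

Definition zadd (p q : Z4) : Z4 :=
  ((fst p + fst q)%Z, ((fst (snd p) + fst (snd q))%Z,
   ((fst (snd (snd p)) + fst (snd (snd q)))%Z,
    (snd (snd (snd p)) + snd (snd (snd q)))%Z))).
Definition zopp (p : Z4) : Z4 :=
  ((- fst p)%Z, ((- fst (snd p))%Z, ((- fst (snd (snd p)))%Z, (- snd (snd (snd p)))%Z))).
(** A triple (m, (l, k)) goes to v = m + l + k, w = l - k, so v + w = m + 2l and v - w = m + 2k. In
    the notation of the overview s/2 = a + m/2 + l and d/2 = m/2 + k. *)
Definition pair_of (x : B4 * (Z4 * Z4)) : Z4 * Z4 :=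
  (zadd (bits (fst x)) (zadd (fst (snd x)) (snd (snd x))),
   zadd (fst (snd x)) (zopp (snd (snd x)))).

Lemma pair_of_inj : Injective pair_of.
Proof.
  assert (H : forall b l k b' l' k',
    (Z.b2z b + (l + k))%Z = (Z.b2z b' + (l' + k'))%Z -> (l + - k)%Z = (l' + - k')%Z ->
    b = b' /\ l = l' /\ k = k').
  { intros [] l k [] l' k'; simpl Z.b2z; intros; (split; [|lia]); try easy; lia. }
  intros ((m0 & m1 & m2 & m3) & (l0 & l1 & l2 & l3) & (k0 & k1 & k2 & k3))
    ((m0' & m1' & m2' & m3') & (l0' & l1' & l2' & l3') & (k0' & k1' & k2' & k3')) E.
  unfold pair_of, zadd, zopp, bits in E. cbn [fst snd] in E.
  injection E as E0 E1 E2 E3 F0 F1 F2 F3.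
  destruct (H _ _ _ _ _ _ E0 F0) as (-> & -> & ->).
  destruct (H _ _ _ _ _ _ E1 F1) as (-> & -> & ->).
  destruct (H _ _ _ _ _ _ E2 F2) as (-> & -> & ->).
  destruct (H _ _ _ _ _ _ E3 F3) as (-> & -> & ->).
  reflexivity.
Qed.

Lemma pair_of_surj y : exists x, pair_of x = y.
Proof.
  assert (H : forall v w, exists b l k, (Z.b2z b + (l + k))%Z = v /\ (l + - k)%Z = w).
  { intros v w. exists (Z.odd (v - w)), (w + (v - w) / 2)%Z, ((v - w) / 2)%Z.
    rewrite <- Z.div2_div. assert (E := Z.div2_odd (v - w)). lia. }
  destruct y as ((v0 & v1 & v2 & v3) & (w0 & w1 & w2 & w3)).
  destruct (H v0 w0) as (m0 & l0 & k0 & <- & <-).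
  destruct (H v1 w1) as (m1 & l1 & k1 & <- & <-).
  destruct (H v2 w2) as (m2 & l2 & k2 & <- & <-).
  destruct (H v3 w3) as (m3 & l3 & k3 & <- & <-).
  now exists ((m0, (m1, (m2, m3))), ((l0, (l1, (l2, l3))), (k0, (k1, (k2, k3))))).
Qed.

Lemma BilCE x z : BilC x z = (Bil x (fun j => Re (z j)), Bil x (fun j => Im (z j))).
Proof. rewrite <- Re_BilC, <- Im_BilC. now destruct (BilC x z). Qed.

Lemma ee_shift w w' k : w = Cplus w' (RtoC (IZR k)) -> ee w = ee w'.
Proof. intros ->. rewrite ee_plus, ee_Z. apply Cmult_1_r. Qed.

Definition zzero : nat -> C := fun _ => RtoC 0.
Definition zdouble (z : nat -> C) : nat -> C := fun j => Cmult (RtoC 2) (z j).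

Lemma halfZ4E b : in_halfZ4 b -> exists k : Z4, forall i, (i < 4)%nat -> b i = half k i.
Proof.
  intros H. destruct (H 0%nat) as [k0 E0]; [lia|]. destruct (H 1%nat) as [k1 E1]; [lia|].
  destruct (H 2%nat) as [k2 E2]; [lia|]. destruct (H 3%nat) as [k3 E3]; [lia|].
  exists (k0, (k1, (k2, k3))). intros i Hi.
  destruct i as [|[|[|[|i]]]]; easy || lia.
Qed.

(** The parallelogram law gives Q(a+v) + Q(a+w) = 2 (Q(s/2) + Q(d/2)), whence the doubled [tau]; the
    linear term B(s,z) is B(s/2, 2z), so [z] doubles in one factor and vanishes in the other. *)
Lemma theta_term_pair a b tau z x : in_halfZ4 b ->
  Cmult (theta_term a b tau z (zfun (fst (pair_of x))))
        (theta_term a b tau z (zfun (snd (pair_of x))))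
  = Cmult (ee (RtoC (Bil b (rfun (bits (fst x))))))
      (Cmult (theta_term (vadd a (half (bits (fst x)))) zero4 (Cmult (RtoC 2) tau) (zdouble z)
               (zfun (fst (snd x))))
             (theta_term (half (bits (fst x))) zero4 (Cmult (RtoC 2) tau) zzero
               (zfun (snd (snd x))))).
Proof.
  intros Hb. destruct (halfZ4E b Hb) as [k Hk].
  destruct x as (m & l & n). cbn [fst snd].
  unfold theta_term. rewrite <- !ee_plus.
  (* With k = 2b this is the integer B(k,l) = 2B(b,l), the amount by which B(b,v+w) exceeds
     B(b,m). *)
  pose (K := (2 * (zfun k 0%nat * zfun l 0%nat + zfun k 1%nat * zfun l 1%nat
                   + zfun k 2%nat * zfun l 2%nat + zfun k 3%nat * zfun l 3%nat)
    - zfun k 0%nat * zfun l 1%nat - zfun k 1%nat * zfun l 0%nat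
    - zfun k 1%nat * zfun l 2%nat - zfun k 2%nat * zfun l 1%nat
    - zfun k 1%nat * zfun l 3%nat - zfun k 3%nat * zfun l 1%nat)%Z).
  apply (ee_shift _ _ K).
  rewrite !BilCE. unfold Qf. rewrite !BilE, !Hk by lia.
  unfold K. rewrite !minus_IZR, !mult_IZR, !plus_IZR, !mult_IZR.
  unfold half, rfun, vadd, zdouble, zzero, Zvec, zero4, pair_of, zadd, zopp, vec4, RtoC.
  cbn [zfun fst snd]. rewrite !plus_IZR, !opp_IZR.
  generalize (IZR (fst (bits m))) (IZR (fst (snd (bits m))))
    (IZR (fst (snd (snd (bits m))))) (IZR (snd (snd (snd (bits m))))).
  intros m0 m1 m2 m3.
  destruct tau as [t u].
  apply injective_projections; unfold Cplus, Cmult, Re, Im; cbn [fst snd]; field.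
Qed.

Lemma theta2_expand a b tau z : in_halfZ4 b -> 0 < Im tau ->
  theta2 a b tau z
  = lsum (fun m => Cmult (ee (RtoC (Bil b (rfun (bits m)))))
      (Cmult (theta (vadd a (half (bits m))) zero4 (Cmult (RtoC 2) tau) (zdouble z))
             (theta (half (bits m)) zero4 (Cmult (RtoC 2) tau) zzero))) cube.
Proof.
  intros Hb Ht.
  assert (Ht2 : 0 < Im (Cmult (RtoC 2) tau)) by (simpl; unfold Im in Ht; lra).
  pose (t := fun p => theta_term a b tau z (zfun p)).
  pose (f := fun y : Z4 * Z4 => Cmult (t (fst y)) (t (snd y))).
  assert (Hf : summable (fun y => Cmod (f y))).
  { assert (H := summable_theta_term a b tau z Ht).
    apply (summable_le _ _ 1) with (3 := summable_prod _ _ H H); [lra|].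
    intros y. unfold f. rewrite Cmod_mult, Rmult_1_l. apply Rle_refl. }
  assert (HE := exhausts_prod _ _ exhausts_box exhausts_box).
  (* One sequence of partial sums has both sides as limits: the square after rearranging to products
     of boxes, the right side after splitting along the classes. *)
  apply (Clim_unique (fun N => lsum f (map pair_of
           (list_prod cube (list_prod (box N) (box N)))))).
  - apply (Clim_rearrange _ (fun N => list_prod (box N) (box N))); [easy..| |].
    + apply exhausts_map; [apply pair_of_inj|apply pair_of_surj|].
      apply (exhausts_prod (fun _ => cube)); [apply exhausts_cube|easy].
    + eapply Clim_ext; [|apply Clim_mult; apply theta_cv, Ht].
      intros N. symmetry. apply (lsum_Cmult_prod t t).
  - eapply Clim_ext; [|apply Clim_lsum; intros m; apply Clim_mult; [apply Clim_const|];
      apply Clim_mult; apply theta_cv, Ht2].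
    intros N. cbv beta. rewrite lsum_map, lsum_list_prod. apply lsum_ext. intros m.
    rewrite <- lsum_Cmult_prod, <- lsum_Cmult_l. apply lsum_ext. intros p.
    symmetry. apply (theta_term_pair _ _ _ _ (m, p) Hb).
Qed.

(** * Parity classes and isometries of the lattice *)

Definition par (n : Z4) : B4 :=
  (Z.odd (fst n), (Z.odd (fst (snd n)), (Z.odd (fst (snd (snd n))), Z.odd (snd (snd (snd n)))))).

Definition bxor (m n : B4) : B4 :=
  (xorb (fst m) (fst n), (xorb (fst (snd m)) (fst (snd n)),
   (xorb (fst (snd (snd m))) (fst (snd (snd n))),
    xorb (snd (snd (snd m))) (snd (snd (snd n)))))).

Lemma Qf_ext x y : (forall i, (i < 4)%nat -> x i = y i) -> Qf x = Qf y.
Proof. intros H. unfold Qf. rewrite !BilE, !H by lia. reflexivity. Qed.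

Lemma BilC_ext x y z : (forall i, (i < 4)%nat -> x i = y i) -> BilC x z = BilC y z.
Proof. intros H. rewrite !BilCE, !BilE, !H by lia. reflexivity. Qed.

Lemma Bil_zero4 x : Bil zero4 x = 0.
Proof. rewrite BilE. unfold zero4, vec4. ring. Qed.

Lemma theta_term_zero4 a tau z v :
  theta_term a zero4 tau z v
  = ee (Cplus (Cmult tau (RtoC (Qf (vadd a (Zvec v))))) (BilC (vadd a (Zvec v)) z)).
Proof. unfold theta_term. now rewrite Bil_zero4, (ee_Z 0), Cmult_1_l. Qed.

Lemma theta_translate a a' n tau z : 0 < Im tau ->
  (forall i, (i < 4)%nat -> a' i = a i + rfun n i) ->
  theta a' zero4 tau z = theta a zero4 tau z.
Proof.
  intros Ht H. rewrite <- (Cmult_1_l (theta a zero4 tau z)).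
  apply (theta_reindex (zadd n)); try easy.
  - intros p q E. destruct p as (p0 & p1 & p2 & p3), q as (q0 & q1 & q2 & q3).
    unfold zadd in E. cbn [fst snd] in E. injection E as E0 E1 E2 E3.
    repeat f_equal; lia.
  - intros q. exists (zadd (zopp n) q). destruct q as (q0 & q1 & q2 & q3).
    unfold zadd, zopp. cbn [fst snd]. repeat f_equal; lia.
  - intros p. rewrite Cmult_1_l, !theta_term_zero4.
    assert (E : forall i, (i < 4)%nat ->
      vadd a' (Zvec (zfun p)) i = vadd a (Zvec (zfun (zadd n p))) i).
    { intros i Hi. unfold vadd, Zvec. rewrite H by easy. unfold rfun, Zvec, zadd.
      destruct i as [|[|[|[|i]]]]; cbn [zfun fst snd]; try lia; rewrite plus_IZR; ring. }
    now rewrite (Qf_ext _ _ E), (BilC_ext _ _ _ E).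
Qed.

(** Replacing n by its residues modulo 2 moves n/2 by the lattice vector of the quotients
    [Z.div2]. *)
Lemma theta_par a n tau z : 0 < Im tau ->
  (forall i, (i < 4)%nat -> a i = half n i) ->
  theta a zero4 tau z = theta (half (bits (par n))) zero4 tau z.
Proof.
  intros Ht H.
  apply (theta_translate _ _ (Z.div2 (fst n), (Z.div2 (fst (snd n)),
    (Z.div2 (fst (snd (snd n))), Z.div2 (snd (snd (snd n))))))); [easy|].
  intros i Hi. rewrite H by easy. unfold half, rfun, Zvec, bits, par.
  assert (E : forall k, IZR k / 2 = IZR (Z.b2z (Z.odd k)) / 2 + IZR (Z.div2 k)).
  { intros k. rewrite (Z.div2_odd k) at 1. rewrite plus_IZR, mult_IZR. field. }
  destruct i as [|[|[|[|i]]]]; cbn [zfun fst snd]; try lia; apply E.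
Qed.

Lemma par_zadd_bits n m : par (zadd n (bits m)) = bxor (par n) m.
Proof.
  assert (E : forall k b, Z.odd (k + Z.b2z b) = xorb (Z.odd k) b).
  { intros k b. rewrite Z.odd_add. now destruct b. }
  destruct m as (m0 & m1 & m2 & m3). unfold par, zadd, bits, bxor. cbn [fst snd].
  now rewrite !E.
Qed.

(** For a linear involution the second clause is Q(g(x)) = Q(x) at x = m/2 + g(p), phrased so that
    [g] is never extended beyond integer vectors. *)
Definition isometry (g : Z4 -> Z4) : Prop :=
  (forall p, g (g p) = p) /\
  (forall m p, Qf (vadd (half (g m)) (rfun p)) = Qf (vadd (half m) (rfun (g p)))).

Lemma theta_isometry g m tau : isometry g -> 0 < Im tau ->
  theta (half (g m)) zero4 tau zzero = theta (half m) zero4 tau zzero.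
Proof.
  intros [Hi Hg] Ht. rewrite <- (Cmult_1_l (theta (half m) zero4 tau zzero)).
  apply (theta_reindex g); try easy.
  - intros p q E. now rewrite <- (Hi p), E.
  - intros q. now exists (g q).
  - intros p. rewrite Cmult_1_l, !theta_term_zero4.
    assert (E := Hg m p). unfold rfun in E. rewrite E. do 2 f_equal.
    rewrite !BilCE, !BilE. unfold zzero. simpl. f_equal; ring.
Qed.

(* The four simple reflections ([i < 4]) and two symmetries of the Dynkin diagram. *)
Definition refl (i : nat) (p : Z4) : Z4 :=
  let '(x0, (x1, (x2, x3))) := p in
  match i with
  | 0%nat => (x1 - x0, (x1, (x2, x3)))
  | 1%nat => (x0, (x0 + x2 + x3 - x1, (x2, x3)))
  | 2%nat => (x0, (x1, (x1 - x2, x3)))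
  | 3%nat => (x0, (x1, (x2, x1 - x3)))
  | 4%nat => (x2, (x1, (x0, x3)))
  | _ => (x0, (x1, (x3, x2)))
  end%Z.

Lemma isometry_refl i : isometry (refl i).
Proof.
  split.
  - intros (x0 & x1 & x2 & x3).
    destruct i as [|[|[|[|[|i]]]]]; simpl; repeat f_equal; lia.
  - intros (m0 & m1 & m2 & m3) (x0 & x1 & x2 & x3).
    unfold Qf. rewrite !BilE. unfold vadd, half, rfun, Zvec.
    destruct i as [|[|[|[|[|i]]]]]; cbn [refl zfun fst snd];
      rewrite ?minus_IZR, ?plus_IZR; field.
Qed.

(** The first test says that m is not in 2L^#: G m is even exactly when m_1 and m_0 + m_2 + m_3 are
    even. *)
Definition hval (h0 h1 h2 : C) (m : B4) : C :=
  let '(m0, (m1, (m2, m3))) := m in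
  if (m1 || xorb m0 (xorb m2 m3))%bool then h2
  else if (m0 || m2 || m3)%bool then h1 else h0.

Definition theta_half (tau : C) (z : nat -> C) (m : B4) : C :=
  theta (half (bits m)) zero4 tau z.
Notation thnull tau := (theta_half tau zzero).

Lemma thnull_refl i m tau : 0 < Im tau ->
  thnull tau (par (refl i (bits m))) = thnull tau m.
Proof.
  intros Ht. unfold theta_half.
  rewrite <- (theta_par (half (refl i (bits m)))) by easy.
  now apply theta_isometry; [apply isometry_refl|].
Qed.

(* Up to isometry, L/2L has three classes: 0, the rest of 2L^#/2L, and the classes of roots. *)
Lemma thnull_hval tau m : 0 < Im tau ->
  thnull tau m = hval (thnull tau (false, (false, (false, false))))
    (thnull tau (false, (false, (true, true))))
    (thnull tau (true, (false, (false, false)))) m.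
Proof.
  intros Ht. pose (H := fun i m => thnull_refl i m tau Ht).
  (* [E1] and [E2] link the three nonzero classes of 2L^# by diagram symmetries; [F1] to [F11] form
     a spanning tree of reflections on the twelve root classes. *)
  assert (E1 := H 4%nat (false, (false, (true, true)))).
  assert (E2 := H 5%nat (true, (false, (false, true)))).
  assert (F1 := H 1%nat (true, (false, (false, false)))).
  assert (F2 := H 0%nat (true, (true, (false, false)))).
  assert (F3 := H 2%nat (false, (true, (false, false)))).
  assert (F4 := H 3%nat (false, (true, (true, false)))).
  assert (F5 := H 0%nat (false, (true, (true, true)))).
  assert (F6 := H 1%nat (true, (true, (true, true)))).
  assert (F7 := H 1%nat (false, (true, (true, false)))).
  assert (F8 := H 3%nat (false, (true, (false, false)))).
  assert (F9 := H 1%nat (false, (true, (false, true)))).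
  assert (F10 := H 2%nat (true, (true, (false, false)))).
  assert (F11 := H 3%nat (true, (true, (false, false)))).
  unfold par in *. cbn in *.
  destruct m as ([] & [] & [] & []); cbn; congruence.
Qed.

(** * Characters of L/2L and the quadratic relation *)

Definition sgn (b : bool) : C := if b then Copp (RtoC 1) else RtoC 1.

Lemma ee_half_Z n : ee (RtoC (IZR n / 2)) = sgn (Z.odd n).
Proof.
  rewrite (Z.div2_odd n) at 1. destruct (Z.odd n); simpl Z.b2z; unfold sgn.
  - rewrite ee_half_odd. apply injective_projections; simpl; ring.
  - rewrite <- (ee_Z (Z.div2 n)). f_equal. f_equal.
    rewrite plus_IZR, mult_IZR. field.
Qed.

(* [B(k, m)] modulo 2. *)
Definition chi (k m : B4) : bool :=
  xorb (fst (snd m) && xorb (fst k) (xorb (fst (snd (snd k))) (snd (snd (snd k)))))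
    (fst (snd k) && xorb (fst m) (xorb (fst (snd (snd m))) (snd (snd (snd m))))).

Lemma ee_Bil_half b k m : (forall i, (i < 4)%nat -> b i = half k i) ->
  ee (RtoC (Bil b (rfun (bits m)))) = sgn (chi (par k) m).
Proof.
  intros H. pose (x := zfun (bits m)). pose (y := zfun k).
  (* B(b,m) = B(k,m)/2; opposites replace subtractions so that [Z.odd_add] and [Z.odd_opp] compute
     the parity. *)
  assert (E : Bil b (rfun (bits m)) =
    IZR (2 * (y 0%nat * x 0%nat + y 1%nat * x 1%nat + y 2%nat * x 2%nat + y 3%nat * x 3%nat)
     + - y 0%nat * x 1%nat + - y 1%nat * x 0%nat + - y 1%nat * x 2%nat + - y 2%nat * x 1%nat
     + - y 1%nat * x 3%nat + - y 3%nat * x 1%nat) / 2).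
  { rewrite BilE, !H by lia. unfold half, rfun, Zvec. fold x y.
    rewrite !plus_IZR, !mult_IZR, !opp_IZR, !plus_IZR, !mult_IZR. field. }
  rewrite E, ee_half_Z. f_equal.
  rewrite !Z.odd_add, !Z.odd_mul, !Z.odd_opp.
  unfold x, y, chi, par. destruct m as ([] & [] & [] & []); cbn;
    destruct (Z.odd (fst k)), (Z.odd (fst (snd k))), (Z.odd (fst (snd (snd k)))),
      (Z.odd (snd (snd (snd k)))); reflexivity.
Qed.

(** All squares at a given point become finite combinations of the same sixteen values of
    [theta_half], with coefficients depending only on n and k modulo 2 and on three constants. *)
Lemma theta2_hval a b n k tau z : 0 < Im tau ->
  (forall i, (i < 4)%nat -> a i = half n i) ->
  (forall i, (i < 4)%nat -> b i = half k i) ->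
  let h m := thnull (Cmult (RtoC 2) tau) m in
  theta2 a b tau z
  = lsum (fun m => Cmult (sgn (chi (par k) m))
      (Cmult (theta_half (Cmult (RtoC 2) tau) (zdouble z) (bxor (par n) m))
         (hval (h (false, (false, (false, false)))) (h (false, (false, (true, true))))
            (h (true, (false, (false, false)))) m))) cube.
Proof.
  intros Ht Ha Hb h.
  assert (Ht2 : 0 < Im (Cmult (RtoC 2) tau)) by (simpl; unfold Im in Ht; lra).
  rewrite theta2_expand; [|intros i Hi; exists (zfun k i); now apply Hb|easy].
  apply lsum_ext. intros m. rewrite (ee_Bil_half b k m Hb).
  apply (f_equal (Cmult _)), f_equal2.
  - unfold theta_half. rewrite <- par_zadd_bits. apply theta_par; [easy|]. intros i Hi.
    unfold vadd. rewrite Ha by easy. unfold half, rfun, Zvec, zadd.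
    destruct i as [|[|[|[|i]]]]; cbn [zfun fst snd]; try lia; rewrite plus_IZR; field.
  - apply thnull_hval. exact Ht2.
Qed.

Lemma LdualE a : in_Ldual a -> exists n,
  (forall i, (i < 4)%nat -> a i = half n i)
  /\ fst (snd (par n)) = false
  /\ xorb (fst (par n)) (xorb (fst (snd (snd (par n)))) (snd (snd (snd (par n))))) = false.
Proof.
  intros H.
  destruct (H (zfun (1, (0, (0, 0))))%Z) as [k0 E0].
  destruct (H (zfun (0, (1, (0, 0))))%Z) as [k1 E1].
  destruct (H (zfun (0, (0, (1, 0))))%Z) as [k2 E2].
  destruct (H (zfun (0, (0, (0, 1))))%Z) as [k3 E3].
  rewrite BilE in E0, E1, E2, E3. unfold Zvec in *. cbn in E0, E1, E2, E3.
  (* The vector 2a is recovered from the values k_i = B(a,e_i) by the integral matrix 2G^{-1}. *)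
  exists (2 * k1 + 2 * k0 + k2 + k3, (2 * (2 * k1 + k0 + k2 + k3),
    (2 * k1 + k0 + 2 * k2 + k3, 2 * k1 + k0 + k2 + 2 * k3)))%Z.
  split; [|split].
  - intros i Hi. unfold half, rfun, Zvec.
    destruct i as [|[|[|[|i]]]]; cbn [zfun fst snd]; try lia;
      rewrite ?mult_IZR, ?plus_IZR, ?mult_IZR; lra.
  - cbn [par fst snd]. now rewrite Z.odd_mul.
  - cbn [par fst snd]. rewrite !Z.odd_add, !Z.odd_mul.
    now destruct (Z.odd k0), (Z.odd k2), (Z.odd k3).
Qed.

(** The difference of the sides is the sum over m of h(m)(chi(m) - 1)(t(n+m) - t(m)). The second
    factor vanishes on 2L^#; on every other coset h and chi are constant, while translation by n
    permutes the coset. *)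
Lemma theta2_relation a b tau z : in_Ldual a -> in_halfZ4 b -> 0 < Im tau ->
  Cplus (theta2 a b tau z) (theta2 zero4 zero4 tau z)
  = Cplus (theta2 a zero4 tau z) (theta2 zero4 b tau z).
Proof.
  intros Ha Hb Ht.
  destruct (LdualE a Ha) as (n & Hn & Hn1 & Hn2). destruct (halfZ4E b Hb) as [k Hk].
  assert (H0 : forall i, (i < 4)%nat -> zero4 i = half (0, (0, (0, 0)))%Z i).
  { intros i Hi. unfold zero4, vec4, half, rfun, Zvec.
    destruct i as [|[|[|[|i]]]]; cbn [zfun fst snd]; try lia; field. }
  rewrite (theta2_hval a b n k), (theta2_hval a zero4 n _), (theta2_hval zero4 b _ k),
    (theta2_hval zero4 zero4 _ _) by eassumption.
  generalize (thnull (Cmult (RtoC 2) tau)). intros h.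
  generalize (theta_half (Cmult (RtoC 2) tau) (zdouble z)). intros t.
  change (par (0, (0, (0, 0)))%Z) with (false, (false, (false, false))).
  (* Only the four classes in 2L^# survive; with the sixteen characters they leave 64 identities in
     indeterminate [t] and [h]. *)
  destruct (par n) as ([] & [] & [] & []); try discriminate; clear;
    destruct (par k) as ([] & [] & [] & []); 
    unfold cube, lsum, chi, hval, bxor;
    cbn [list_prod map app fold_right fst snd xorb andb orb sgn];
    change (@plus C_AbelianMonoid) with Cplus; change (@zero C_AbelianMonoid) with (RtoC 0); ring.
Qed.

(** * Theta constants on the imaginary axis *)

Definition gauss (y : R) (m : B4) (p : Z4) : R :=
  exp (- (2 * PI * (y * Qf (vadd (half (bits m)) (rfun p))))).

(** At tau = iy and z = 0 every term is a positive real, so the imaginary parts of the partial sums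
    vanish. *)
Lemma thnull_cv y m : 0 < y ->
  thnull (0, y) m = RtoC (Re (thnull (0, y) m))
  /\ is_lim_seq (fun N => lsum (gauss y m) (box N)) (Re (thnull (0, y) m)).
Proof.
  intros Hy.
  assert (E : forall p, theta_term (half (bits m)) zero4 (0, y) zzero (zfun p)
                        = RtoC (gauss y m p)).
  { intros p. rewrite theta_term_zero4, BilCE. fold (rfun p).
    replace (Cplus _ _) with ((0, y * Qf (vadd (half (bits m)) (rfun p))) : C).
    - unfold ee, gauss. simpl. rewrite Rmult_0_r, cos_0, sin_0.
      apply injective_projections; simpl; ring.
    - rewrite !BilE. unfold zzero. apply injective_projections; simpl; ring. }
  destruct (theta_cv (half (bits m)) zero4 (0, y) zzero Hy) as [H1 H2].
  fold (theta_half (0, y) zzero m) in H1, H2. split.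
  - apply injective_projections; [reflexivity|].
    apply is_lim_seq_unique in H2.
    rewrite (Lim_seq_ext _ (fun _ => 0)) in H2.
    + rewrite Lim_seq_const in H2. injection H2 as H2. simpl. symmetry. exact H2.
    + intros N. rewrite Im_lsum, (lsum_ext _ (fun _ => 0 * 0)).
      * rewrite (lsum_scal_l (fun _ => 0)). ring.
      * intros p. rewrite E. simpl. ring.
  - eapply is_lim_seq_ext; [|exact H1]. intros N. cbv beta. rewrite Re_lsum. apply lsum_ext.
    intros p. now rewrite E.
Qed.

Lemma gauss_le_thnull y m p : 0 < y -> gauss y m p <= Re (thnull (0, y) m).
Proof.
  intros Hy. destruct (thnull_cv y m Hy) as [_ H].
  destruct exhausts_box as [_ HE].
  apply (is_lim_seq_le_loc (fun _ => gauss y m p) (fun N => lsum (gauss y m) (box N))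
    (Rbar.Finite _) (Rbar.Finite _)); [|apply is_lim_seq_const|exact H].
  generalize (HE p). apply filter_imp. intros N HN.
  replace (gauss y m p) with (lsum (gauss y m) (p :: nil)) by apply Rplus_0_r.
  apply lsum_incl_le.
  - intros q. left. apply exp_pos.
  - repeat constructor. easy.
  - intros q [<-|[]]. exact HN.
Qed.

(** Termwise, raising y to y' multiplies by exp(-2 pi Q (y' - y)), and Q is at least c. *)
Lemma thnull_decay c y y' m :
  0 < y -> y <= y' -> (forall p, c <= Qf (vadd (half (bits m)) (rfun p))) ->
  Re (thnull (0, y') m) <= exp (- (2 * PI * c * (y' - y))) * Re (thnull (0, y) m).
Proof.
  intros Hy Hyy' Hc.
  destruct (thnull_cv y m Hy) as [_ H]. destruct (thnull_cv y' m ltac:(lra)) as [_ H'].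
  apply (is_lim_seq_le (fun N => lsum (gauss y' m) (box N))
    (fun N => exp (- (2 * PI * c * (y' - y))) * lsum (gauss y m) (box N))
    (Rbar.Finite _) (Rbar.Finite _)); [|exact H'|exact (is_lim_seq_scal_l _ _ (Rbar.Finite _) H)].
  intros N. rewrite <- lsum_scal_l. apply lsum_le. intros p.
  unfold gauss. rewrite <- exp_plus. apply exp_le_compat.
  specialize (Hc p). assert (Hpi := PI_RGT_0).
  assert (0 <= 2 * PI * (y' - y) * (Qf (vadd (half (bits m)) (rfun p)) - c));
    [apply Rmult_le_pos; [apply Rmult_le_pos|]; lra|lra].
Qed.

Lemma thnull_separated : exists y h0 h1 h2,
  0 < y /\ 0 < h1 < h0 /\ 0 < h2
  /\ thnull (Cmult (RtoC 2) (0, y)) (false, (false, (false, false))) = RtoC h0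
  /\ thnull (Cmult (RtoC 2) (0, y)) (false, (false, (true, true))) = RtoC h1
  /\ thnull (Cmult (RtoC 2) (0, y)) (true, (false, (false, false))) = RtoC h2.
Proof.
  pose (o := (0, (0, (0, 0)))%Z : Z4).
  assert (Hpi := PI_RGT_0).
  assert (Hp : forall y m, 0 < y -> 0 < Re (thnull (0, y) m)).
  { intros y m Hy. eapply Rlt_le_trans; [|apply (gauss_le_thnull y m o Hy)].
    apply exp_pos. }
  pose (r := Re (thnull (0, 1) (false, (false, (true, true))))).
  assert (Hr : 0 < r) by (apply Hp; lra).
  (* Chosen so that 2 pi (y - 1)/32 = r: the decay factor is then exp(-r), and r exp(-r) < 1. *)
  pose (y := 1 + 16 * r / PI).
  assert (Hy : 1 < y).
  { assert (0 < 16 * r / PI) by (apply Rdiv_lt_0_compat; lra). unfold y; lra. }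
  (* The theta constants are taken at 2 tau, hence the half. *)
  exists (y / 2), (Re (thnull (0, y) (false, (false, (false, false))))),
    (Re (thnull (0, y) (false, (false, (true, true))))),
    (Re (thnull (0, y) (true, (false, (false, false))))).
  replace (Cmult (RtoC 2) (0, y / 2)) with ((0, y) : C)
    by (apply injective_projections; simpl; field).
  split; [lra|]. split; [split; [apply Hp; lra|]|].
  2: { split; [apply Hp; lra|].
       split; [|split]; apply thnull_cv; lra. }
  (* The number 1 separates them: h1 has decayed below it, while the term at the origin alone
     contributes 1 to h0. *)
  apply Rlt_le_trans with 1.
  - eapply Rle_lt_trans; [apply (thnull_decay (1 / 32) 1); [lra|lra|]|].
    + intros p. unfold Qf. rewrite BilE. unfold vadd, half, rfun, Zvec.
      set (x0 := _ + IZR (zfun p 0)). set (x1 := _ + IZR (zfun p 1)).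
      set (x2 := _ + IZR (zfun p 2)). set (x3 := _ + IZR (zfun p 3)).
      (* This coordinate is a half-integer, so Q is at least x_2^2/8, that is at least 1/32. *)
      assert (Hx : 1 / 4 <= x2 ^ 2).
      { unfold x2. simpl zfun. simpl Z.b2z. generalize (fst (snd (snd p))). intros k.
        destruct (Z_le_gt_dec 0 k) as [Hk|Hk].
        - apply IZR_le in Hk. nra.
        - assert (Hk' : (k <= -1)%Z) by lia. apply IZR_le in Hk'. nra. }
      assert (Hx0 := pow2_ge_0 (x0 - 4 / 7 * x1)).
      assert (Hx2 := pow2_ge_0 (x2 - 4 / 7 * x1)).
      assert (Hx3 := pow2_ge_0 (x3 - 4 / 7 * x1)).
      assert (Hx1 := pow2_ge_0 x1). assert (Hx0' := pow2_ge_0 x0).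
      assert (Hx3' := pow2_ge_0 x3). nra.
    + fold r. replace (2 * PI * (1 / 32) * (y - 1)) with r by (unfold y; field; lra).
      assert (H := exp_ineq1 r ltac:(lra)).
      rewrite exp_Ropp. apply Rmult_lt_reg_l with (exp r); [apply exp_pos|].
      rewrite <- Rmult_assoc, Rinv_r; lra.
  - eapply Rle_trans; [|apply (gauss_le_thnull y _ o); lra].
    unfold gauss, Qf. rewrite BilE. unfold vadd, half, rfun, Zvec. simpl.
    rewrite <- exp_0 at 1. apply exp_le_compat. lra.
Qed.

(** * Evaluation at points that realise the characters of L/2L *)

Definition dot (w m : B4) : bool :=
  xorb (fst w && fst m) (xorb (fst (snd w) && fst (snd m))
    (xorb (fst (snd (snd w)) && fst (snd (snd m))) (snd (snd (snd w)) && snd (snd (snd m))))).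

(* The solution [z] of [B(x, 2z) = sum_i w_i x_i]. *)
Definition dual_point (w : B4) : nat -> C :=
  let x := rfun (bits w) in
  fun j => RtoC (vec4 (x 0%nat + x 1%nat + x 2%nat / 2 + x 3%nat / 2)
    (x 0%nat + 2 * x 1%nat + x 2%nat + x 3%nat)
    (x 0%nat / 2 + x 1%nat + x 2%nat + x 3%nat / 2)
    (x 0%nat / 2 + x 1%nat + x 2%nat / 2 + x 3%nat) j / 2).

(** At x = m/2 + p the factor e(B(x,2z)) is e(w.m/2) e(w.p), and w.p is an integer, so the sign does
    not depend on p. *)
Lemma theta_half_dual_point tau w m : 0 < Im tau ->
  theta_half tau (zdouble (dual_point w)) m = Cmult (sgn (dot w m)) (thnull tau m).
Proof.
  intros Ht. unfold theta_half. apply (theta_reindex (fun p => p)); try easy.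
  - intros q. now exists q.
  - intros p. rewrite !theta_term_zero4. pose (x := zfun (bits w)). pose (n := zfun (bits m)).
    rewrite !BilCE.
    pose (K := (x 0%nat * zfun p 0%nat + x 1%nat * zfun p 1%nat
      + x 2%nat * zfun p 2%nat + x 3%nat * zfun p 3%nat)%Z).
    pose (K' := (x 0%nat * n 0%nat + x 1%nat * n 1%nat
      + x 2%nat * n 2%nat + x 3%nat * n 3%nat)%Z).
    replace (sgn (dot w m)) with (ee (RtoC (IZR K' / 2))).
    + rewrite <- ee_plus. apply (ee_shift _ _ K).
      rewrite !BilE. unfold K, K'. rewrite !plus_IZR, !mult_IZR.
      unfold zdouble, dual_point, zzero, vadd, half, rfun, Zvec. fold x n.
      destruct tau as [t u].
      apply injective_projections; unfold RtoC, vec4; simpl; field.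
    + rewrite ee_half_Z. f_equal. unfold K', x, n.
      destruct w as ([] & [] & [] & []), m as ([] & [] & [] & []); reflexivity.
Qed.

(** * Linear independence *)

(** Restates the equation at type [C], since [ring] may otherwise face the carrier of a canonical
    structure. *)
Ltac Cring :=
  match goal with |- @eq _ ?x ?y => change (@eq C x y) end; ring.

Ltac expand_cube := unfold lsum, cube, bxor, dot;
  cbn [list_prod map app fold_right fst snd xorb andb orb sgn];
  change (@plus C_AbelianMonoid) with Cplus; change (@zero C_AbelianMonoid) with (RtoC 0).

Lemma lsum_cube_bxor (g : B4) (f : B4 -> C) :
  lsum (fun m => f (bxor g m)) cube = lsum f cube.
Proof. destruct g as ([] & [] & [] & []); expand_cube; Cring. Qed.

Lemma bxorK g m : bxor g (bxor g m) = m.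
Proof.
  destruct g as ([] & [] & [] & []), m as ([] & [] & [] & []); reflexivity.
Qed.

Lemma cube_fourier_inversion (f : B4 -> C) r :
  lsum (fun w => Cmult (sgn (dot w r)) (lsum (fun m => Cmult (sgn (dot w m)) (f m)) cube)) cube
  = Cmult (RtoC 16) (f r).
Proof. destruct r as ([] & [] & [] & []); expand_cube; Cring. Qed.

(** Substituting n + m for m makes [theta_half] carry the index m, so the right side is a Fourier
    sum in w with explicit coefficients. *)
Lemma theta2_dual_point a b n k tau w : 0 < Im tau ->
  (forall i, (i < 4)%nat -> a i = half n i) ->
  (forall i, (i < 4)%nat -> b i = half k i) ->
  let h m := thnull (Cmult (RtoC 2) tau) m in
  let H := hval (h (false, (false, (false, false)))) (h (false, (false, (true, true))))
             (h (true, (false, (false, false)))) in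
  theta2 a b tau (dual_point w)
  = lsum (fun m => Cmult (sgn (dot w m))
      (Cmult (sgn (chi (par k) (bxor (par n) m))) (Cmult (H m) (H (bxor (par n) m))))) cube.
Proof.
  intros Ht Ha Hb h H.
  assert (Ht2 : 0 < Im (Cmult (RtoC 2) tau)) by (simpl; unfold Im in Ht; lra).
  rewrite (theta2_hval a b n k), <- (lsum_cube_bxor (par n)) by easy.
  apply lsum_ext. intros m.
  rewrite bxorK, theta_half_dual_point, (thnull_hval _ m) by easy.
  fold (h (false, (false, (false, false)))) (h (false, (false, (true, true))))
    (h (true, (false, (false, false)))). fold H. Cring.
Qed.

(** Twice the characteristic alpha of the k-th function; [seven_beta] does the same for beta. *)
Definition seven_alpha (k : nat) : Z4 :=
  match k with
  | 1%nat => (0, (0, (1, 1))) | 2%nat => (1, (0, (0, 1))) | 3%nat => (1, (0, (1, 0)))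
  | _ => (0, (0, (0, 0)))
  end%Z.

Definition seven_beta (k : nat) : Z4 :=
  match k with
  | 0%nat | 1%nat | 2%nat | 3%nat => (0, (0, (0, 0)))
  | 4%nat => (1, (1, (1, 1))) | 5%nat => (1, (0, (0, 0))) | _ => (0, (1, (0, 0)))
  end%Z.

Lemma seven_dual_point k tau w : 0 < Im tau ->
  let h m := thnull (Cmult (RtoC 2) tau) m in
  let H := hval (h (false, (false, (false, false)))) (h (false, (false, (true, true))))
             (h (true, (false, (false, false)))) in
  seven k tau (dual_point w)
  = lsum (fun m => Cmult (sgn (dot w m))
      (Cmult (sgn (chi (par (seven_beta k)) (bxor (par (seven_alpha k)) m)))
         (Cmult (H m) (H (bxor (par (seven_alpha k)) m))))) cube.
Proof.
  intros Ht h H. subst h H.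
  destruct k as [|[|[|[|[|[|k]]]]]]; apply theta2_dual_point; try exact Ht;
    intros i Hi; destruct i as [|[|[|[|i]]]]; try lia;
    unfold half, rfun, Zvec, zero4; cbn; field.
Qed.

Lemma Cmult_eq_0_reg (x a : C) : a <> RtoC 0 -> Cmult x a = RtoC 0 -> x = RtoC 0.
Proof.
  intros Ha H. rewrite <- (Cmult_1_r x), <- (Cinv_r a Ha), Cmult_assoc, H.
  apply Cmult_0_l.
Qed.

Ltac expand_seven := unfold lsum, chi, par, bxor, seven_beta, seven_alpha, hval;
  cbn [seq fold_right fst snd Z.odd xorb andb orb sgn];
  change (@plus C_AbelianMonoid) with Cplus; change (@zero C_AbelianMonoid) with (RtoC 0);
  Cring.

Lemma theta_independent c :
  (forall (tau : C) (z : nat -> C), 0 < Im tau ->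
     sum_n (fun k => Cmult (c k) (seven k tau z)) 6 = RtoC 0) ->
  forall k : nat, (k <= 6)%nat -> c k = RtoC 0.
Proof.
  intros Hc. destruct thnull_separated as (y & h0 & h1 & h2 & Hy & Hh1 & Hh2 & E0 & E1 & E2).
  pose (H := hval (RtoC h0) (RtoC h1) (RtoC h2)).
  (* The k-th contribution to the Fourier coefficient at m, with the common factor [H m] removed. *)
  pose (u := fun m k => Cmult (c k)
    (Cmult (sgn (chi (par (seven_beta k)) (bxor (par (seven_alpha k)) m)))
         (H (bxor (par (seven_alpha k)) m)))).
  (* The combination vanishes at every [dual_point w], so inversion kills each coefficient, and
     [H r] cancels. *)
  assert (Hu : forall r, H r <> RtoC 0 -> lsum (u r) (seq 0 7) = RtoC 0).
  { intros r Hr.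
    assert (E := cube_fourier_inversion (fun m => Cmult (H m) (lsum (u m) (seq 0 7))) r).
    rewrite (lsum_ext _ (fun _ => Cmult (RtoC 0) (RtoC 0))), lsum_Cmult_l in E.
    - cbv beta in E. rewrite Cmult_0_l in E.
      assert (N : Cmult (RtoC 16) (H r) <> RtoC 0).
      { apply Cmult_neq_0; [|easy]. intros N. apply RtoC_inj in N. lra. }
      apply (Cmult_eq_0_reg _ _ N). rewrite Cmult_comm, <- Cmult_assoc.
      symmetry. exact E.
    - intros w. rewrite Cmult_0_l. rewrite <- (Cmult_0_r (sgn (dot w r))). f_equal.
      rewrite <- (Hc (0, y) (dual_point w) Hy), <- lsum_seq.
      rewrite (lsum_ext (fun k => Cmult (c k) (seven k (0, y) (dual_point w)))
        (fun k => lsum (fun m => Cmult (Cmult (sgn (dot w m)) (H m)) (u m k)) cube)).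
      + rewrite lsum_comm. apply lsum_ext. intros m. rewrite lsum_Cmult_l. Cring.
      + intros k. rewrite seven_dual_point by easy. rewrite E0, E1, E2. fold H.
        rewrite <- lsum_Cmult_l. apply lsum_ext. intros m. unfold u. Cring. }
  assert (N0 : RtoC h0 <> RtoC 0) by (intros N; apply RtoC_inj in N; lra).
  assert (N1 : RtoC h1 <> RtoC 0) by (intros N; apply RtoC_inj in N; lra).
  assert (N2 : RtoC h2 <> RtoC 0) by (intros N; apply RtoC_inj in N; lra).
  assert (L : forall r (s : C), H r <> RtoC 0 -> lsum (u r) (seq 0 7) = s -> s = RtoC 0)
    by (intros r s Hr <-; now apply Hu).
  pose (S := (c 0%nat + c 1%nat + c 2%nat + c 3%nat)%C).
  (* [F0] to [F3] are the equations at the four classes of 2L^#, where all characters are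
     trivial. *)
  assert (F0 : (c 0%nat * h0 + (S - c 0%nat) * h1 + (c 4%nat + c 5%nat + c 6%nat) * h0)%C = RtoC 0).
  { apply (L (false, (false, (false, false))) _ N0). unfold u, H, S. expand_seven. }
  assert (F1 : (c 1%nat * h0 + (S - c 1%nat) * h1 + (c 4%nat + c 5%nat + c 6%nat) * h1)%C = RtoC 0).
  { apply (L (false, (false, (true, true))) _ N1). unfold u, H, S. expand_seven. }
  assert (F2 : (c 2%nat * h0 + (S - c 2%nat) * h1 + (c 4%nat + c 5%nat + c 6%nat) * h1)%C = RtoC 0).
  { apply (L (true, (false, (false, true))) _ N1). unfold u, H, S. expand_seven. }
  assert (F3 : (c 3%nat * h0 + (S - c 3%nat) * h1 + (c 4%nat + c 5%nat + c 6%nat) * h1)%C = RtoC 0).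
  { apply (L (true, (false, (true, false))) _ N1). unfold u, H, S. expand_seven. }
  (* [G1] to [G3] use one class from each nontrivial coset of 2L^#; all theta constants there are h2
     and only the signs differ. Pairwise sums give c_4 = c_5 = c_6 = S. *)
  assert (G1 : ((S - c 4%nat + c 5%nat - c 6%nat) * h2)%C = RtoC 0).
  { apply (L (true, (false, (false, false))) _ N2). unfold u, H, S. expand_seven. }
  assert (G2 : ((S - c 4%nat - c 5%nat + c 6%nat) * h2)%C = RtoC 0).
  { apply (L (false, (true, (false, false))) _ N2). unfold u, H, S. expand_seven. }
  assert (G3 : ((S + c 4%nat - c 5%nat - c 6%nat) * h2)%C = RtoC 0).
  { apply (L (true, (true, (false, false))) _ N2). unfold u, H, S. expand_seven. }
  assert (N2' : Cmult (RtoC 2) h2 <> RtoC 0)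
    by (rewrite <- RtoC_mult; intros N; apply RtoC_inj in N; lra).
  assert (E4 : (S - c 4%nat)%C = RtoC 0).
  { apply (Cmult_eq_0_reg _ _ N2').
    transitivity ((S - c 4%nat + c 5%nat - c 6%nat) * h2
      + (S - c 4%nat - c 5%nat + c 6%nat) * h2)%C; [ring|rewrite G1, G2; ring]. }
  assert (E5 : (S - c 5%nat)%C = RtoC 0).
  { apply (Cmult_eq_0_reg _ _ N2').
    transitivity ((S - c 4%nat - c 5%nat + c 6%nat) * h2
      + (S + c 4%nat - c 5%nat - c 6%nat) * h2)%C; [ring|rewrite G2, G3; ring]. }
  assert (E6 : (S - c 6%nat)%C = RtoC 0).
  { apply (Cmult_eq_0_reg _ _ N2').
    transitivity ((S - c 4%nat + c 5%nat - c 6%nat) * h2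
      + (S + c 4%nat - c 5%nat - c 6%nat) * h2)%C; [ring|rewrite G1, G3; ring]. }
  (* Exposes the differences known to vanish; the residue S - 0 explains the shape of [s] below. *)
  replace (c 4%nat) with (S - (S - c 4%nat))%C in F0, F1, F2, F3 by ring.
  replace (c 5%nat) with (S - (S - c 5%nat))%C in F0, F1, F2, F3 by ring.
  replace (c 6%nat) with (S - (S - c 6%nat))%C in F0, F1, F2, F3 by ring.
  rewrite E4, E5, E6 in F0, F1, F2, F3.
  (* Adding the four equations yields 4 (h0 + 3 h1) S = 0. With S = 0 each of them reduces to (h0 -
     h1) c_i = 0. *)
  assert (ES : S = RtoC 0).
  { assert (N : Cmult (RtoC 4) (RtoC h0 + RtoC 3 * RtoC h1)%C <> RtoC 0).
    { rewrite <- RtoC_mult, <- RtoC_plus, <- RtoC_mult. intros N. apply RtoC_inj in N. lra. }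
    apply (Cmult_eq_0_reg _ _ N).
    pose (s := (S - 0 + (S - 0) + (S - 0))%C).
    transitivity ((c 0%nat * h0 + (S - c 0%nat) * h1 + s * h0)
      + (c 1%nat * h0 + (S - c 1%nat) * h1 + s * h1)
      + (c 2%nat * h0 + (S - c 2%nat) * h1 + s * h1)
      + (c 3%nat * h0 + (S - c 3%nat) * h1 + s * h1))%C; [unfold s, S; ring|].
    unfold s. rewrite F0, F1, F2, F3. ring. }
  rewrite ES in E4, E5, E6, F0, F1, F2, F3.
  assert (N : (RtoC h0 - RtoC h1)%C <> RtoC 0).
  { rewrite <- RtoC_minus. intros N. apply RtoC_inj in N. lra. }
  intros k Hk. destruct k as [|[|[|[|[|[|[|k]]]]]]]; [..|lia].
  - apply (Cmult_eq_0_reg _ _ N). rewrite <- F0. ring.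
  - apply (Cmult_eq_0_reg _ _ N). rewrite <- F1. ring.
  - apply (Cmult_eq_0_reg _ _ N). rewrite <- F2. ring.
  - apply (Cmult_eq_0_reg _ _ N). rewrite <- F3. ring.
  - transitivity (RtoC 0 - (RtoC 0 - c 4%nat))%C; [ring|rewrite E4; ring].
  - transitivity (RtoC 0 - (RtoC 0 - c 5%nat))%C; [ring|rewrite E5; ring].
  - transitivity (RtoC 0 - (RtoC 0 - c 6%nat))%C; [ring|rewrite E6; ring].
Qed.

Theorem theorem7p11 :
  (forall c : nat -> C,
     (forall (tau : C) (z : nat -> C), 0 < Im tau ->
        sum_n (fun k => Cmult (c k) (seven k tau z)) 6 = RtoC 0) ->
     forall k : nat, (k <= 6)%nat -> c k = RtoC 0)
  /\
  (forall (a b : nat -> R), in_Ldual a -> in_halfZ4 b ->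
     forall (tau : C) (z : nat -> C), 0 < Im tau ->
       Cplus (theta2 a b tau z) (theta2 zero4 zero4 tau z)
       = Cplus (theta2 a zero4 tau z) (theta2 zero4 b tau z)).
Proof.
  split; [exact theta_independent|]. intros a b Ha Hb tau z Ht.
  now apply theta2_relation.
Qed.
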